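(* Let $n\ge 4$, let $P$ be an $n\times n$ pentadiagonal matrix over $K$ ($K=\mathbb{R}$ or $\mathbb{C}$) with entries $P_{i,i}=d_i$, $P_{i,i+1}=a_i$, $P_{i,i+2}=b_i$, $P_{i,i-1}=c_i$, $P_{i,i-2}=e_i$ and all other entries $0$, and let $Y=(y_1,\dots,y_n)^t\in K^n$. If $\det(P)\neq 0$, then the symbolic algorithm SPTRANS-II (described in the context) never fails on $(P,Y)$: all its divisions are defined in $K(p)$, the rational functions $x_1(p),\dots,x_n(p)\in K(p)$ it computes can be evaluated at $p=0$ (they have no pole there), and $X=(x_1(0),\dots,x_n(0))^t$ is the solution of $PX=Y$.
   Context: $K(p)$ is the field of rational functions in one indeterminate $p$ (a symbolic name whose actual value is $0$). The algorithm SPTRANS-II, on input $n\ge4$, the entries of $P$ with $\det(P)\ne0$, and $Y$, performs the following computations in $K(p)$ (tests ''$=0$'' mean equality to $0$ in $K(p)$). (1) Set $\psi_n=d_n$; if $\psi_n=0$, replace $\psi_n$ by $p$. Set $\sigma_n=\frac{c_n}{\psi_n}$, $\phi_n=\frac{e_n}{\psi_n}$, $w_n=\frac{y_n}{\psi_n}$, $\rho_{n-1}=a_{n-1}$. (2) Set $\psi_{n-1}=d_{n-1}-\sigma_n\rho_{n-1}$; if $\psi_{n-1}=0$, replace it by $p$. Set $\sigma_{n-1}=\frac{c_{n-1}-\phi_n\rho_{n-1}}{\psi_{n-1}}$, $\phi_{n-1}=\frac{e_{n-1}}{\psi_{n-1}}$, $w_{n-1}=\frac{y_{n-1}-w_n\rho_{n-1}}{\psi_{n-1}}$.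 (3) For $i=n-2,n-3,\dots,3$ in decreasing order: $\rho_i=a_i-\sigma_{i+2}b_i$; $\psi_i=d_i-\phi_{i+2}b_i-\sigma_{i+1}\rho_i$, and if $\psi_i=0$, replace $\psi_i$ by $p$; $\sigma_i=\frac{c_i-\phi_{i+1}\rho_i}{\psi_i}$; $\phi_i=\frac{e_i}{\psi_i}$; $w_i=\frac{y_i-w_{i+2}b_i-w_{i+1}\rho_i}{\psi_i}$. (4) $\rho_2=a_2-\sigma_4b_2$; $\psi_2=d_2-\phi_4b_2-\sigma_3\rho_2$, and if $\psi_2=0$, replace it by $p$; $\sigma_2=\frac{c_2-\phi_3\rho_2}{\psi_2}$; $\rho_1=a_1-\sigma_3b_1$; $\psi_1=d_1-\phi_3b_1-\sigma_2\rho_1$, and if $\psi_1=0$, replace it by $p$; $w_2=\frac{y_2-w_4b_2-w_3\rho_2}{\psi_2}$; $w_1=\frac{y_1-w_3b_1-w_2\rho_1}{\psi_1}$. (5) $x_1=w_1$, $x_2=w_2-\sigma_2x_1$, and for $i=3,\dots,n$: $x_i=w_i-\sigma_ix_{i-1}-\phi_ix_{i-2}$. (6) Substitute $p=0$ in the (simplified) rational functions $x_i=x_i(p)$, $i=1,\dots,n$, and output the result. *)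

(* Defs.v *)
From HB Require Import structures.
From mathcomp Require Import all_boot all_order all_algebra.
From mathcomp Require Import reals.
From mathcomp Require Import complex.

Set Implicit Arguments.
Unset Strict Implicit.
Unset Printing Implicit Defensive.

Import GRing.Theory.
Local Open Scope ring_scope.

(* Entries carry the usual 1-based subscripts, while matrix indices are 0-based;
   only subscripts that occur in an n x n pentadiagonal matrix are read. *)
Definition penta_mx (K : fieldType) (n : nat) (a b c d e : nat -> K) :
    'M[K]_n :=
  \matrix_(i < n, j < n)
    if j == i :> nat then d i.+1
    else if j == i.+1 :> nat then a i.+1
    else if j == i.+2 :> nat then b i.+1
    else if i == j.+1 :> nat then c i.+1
    else if i == j.+2 :> nat then e i.+1
    else 0.

Section RationalFunctions.

Variable K : fieldType.
Implicit Types (f : {fraction {poly K}}) (u v : {poly K}) (z : K).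

(* The simplified form of f: numerator and denominator of any representative of
   f, divided by their gcd. It is unique up to a common nonzero constant. *)
Definition simpl_num f : {poly K} :=
  let r := repr f in \n_r %/ gcdp \n_r \d_r.

Definition simpl_den f : {poly K} :=
  let r := repr f in \d_r %/ gcdp \n_r \d_r.

Definition has_pole f z : bool := root (simpl_den f) z.

(* The value f(z); meaningful only when f has no pole at z. *)
Definition subst_rat f z : K := (simpl_num f).[z] / (simpl_den f).[z].

Lemma simpl_den_neq0 f : simpl_den f != 0.
Proof. by rewrite dvdp_div_eq0 ?dvdp_gcdr ?denom_ratioP. Qed.

Lemma coprime_simpl f : coprimep (simpl_num f) (simpl_den f).
Proof. by apply: coprimep_div_gcd; rewrite denom_ratioP orbT. Qed.

Lemma simpl_ratE f : f = tofrac (simpl_num f) / tofrac (simpl_den f).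
Proof.
have F0 := denom_ratioP (repr f).
have fE : f * tofrac \d_(repr f) = tofrac \n_(repr f).
  rewrite -{1}[f]reprK; set r := repr f in F0 *.
  unlock tofrac; rewrite -[LHS]FracField.pi_mul; apply/eqmodP => /=.
  rewrite FracField.equivfE /FracField.mulf !numden_Ratio ?mulf_neq0 ?oner_neq0 //.
  by rewrite !mulr1 mulrC.
set g := gcdp \n_(repr f) \d_(repr f).
have g0 : tofrac g != 0 by rewrite tofrac_eq0 gcdp_eq0 negb_and F0 orbT.
apply: (canRL (mulfK _)); first by rewrite tofrac_eq0 simpl_den_neq0.
apply: (mulIf g0); rewrite -mulrA -!tofracM.
by rewrite /simpl_num /simpl_den !divpK ?dvdp_gcdl ?dvdp_gcdr.
Qed.

Lemma subst_rat_frac u v z : v.[z] != 0 ->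
  ~~ has_pole (tofrac u / tofrac v) z /\
  subst_rat (tofrac u / tofrac v) z = u.[z] / v.[z].
Proof.
move=> vz0; set f := _ / _.
have v0 : v != 0 by apply: contraNneq vz0 => ->; rewrite horner0.
have d0 := simpl_den_neq0 f.
have E : u * simpl_den f = simpl_num f * v.
  apply/eqP; rewrite -tofrac_eq !tofracM.
  by rewrite -eqr_div ?tofrac_eq0 // -simpl_ratE.
have dv : simpl_den f %| v.
  have : simpl_den f %| simpl_num f * v by rewrite -E dvdp_mull.
  by rewrite Gauss_dvdpr // coprimep_sym coprime_simpl.
have dz0 : (simpl_den f).[z] != 0.
  case/dvdpP: dv vz0 => q ->; rewrite hornerM.
  by apply: contraNneq => ->; rewrite mulr0.
by split=> //; apply/eqP; rewrite eqr_div // -!hornerM -E.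
Qed.

End RationalFunctions.

Arguments has_pole {K} f z.
Arguments subst_rat {K} f z.

(* A division that fails, returning None, when the divisor is zero. *)
Definition divo (F : fieldType) (x y : F) : option F :=
  if y == 0 then None else Some (x / y).

Notation "x ./ y" := (divo x y) (at level 40, no associativity).
Notation "'let!' x := m 'in' t" := (obind (fun x => t) m)
  (at level 200, x name, m at level 100, t at level 200).

Section Sptrans2.

Variables (K : fieldType) (n : nat) (a b c d e y : nat -> K).

Local Notation Kp := {fraction {poly K}}.
Local Notation "k %:K" := (tofrac (polyC k)) (at level 2, format "k %:K").
Local Notation p := (tofrac ('X : {poly K})).

Definition nonzero_or_p (psi : Kp) : Kp := if psi == 0 then p else psi.

(* The computed values sigma_i, phi_i, w_i attached to an index i. *)
Record row := Row { sigma : Kp; phi : Kp; w : Kp }.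

Definition step1 : option row :=
  let psi := nonzero_or_p (d n)%:K in
  let! sigma_n := (c n)%:K ./ psi in
  let! phi_n := (e n)%:K ./ psi in
  let! w_n := (y n)%:K ./ psi in
  Some (Row sigma_n phi_n w_n).

Definition step2 (r_n : row) : option row :=
  let i := n.-1 in
  let rho := (a i)%:K in
  let psi := nonzero_or_p ((d i)%:K - sigma r_n * rho) in
  let! sigma_i := ((c i)%:K - phi r_n * rho) ./ psi in
  let! phi_i := (e i)%:K ./ psi in
  let! w_i := ((y i)%:K - w r_n * rho) ./ psi in
  Some (Row sigma_i phi_i w_i).

Definition step3 (t : nat -> row) (i : nat) : option row :=
  let rho := (a i)%:K - sigma (t i.+2) * (b i)%:K in
  let psi := nonzero_or_p
    ((d i)%:K - phi (t i.+2) * (b i)%:K - sigma (t i.+1) * rho) in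
  let! sigma_i := ((c i)%:K - phi (t i.+1) * rho) ./ psi in
  let! phi_i := (e i)%:K ./ psi in
  let! w_i := ((y i)%:K - w (t i.+2) * (b i)%:K - w (t i.+1) * rho) ./ psi in
  Some (Row sigma_i phi_i w_i).

(* The loop i = n-2, n-3, ..., 3, storing each new row in the table. *)
Definition step3_loop (t : nat -> row) : option (nat -> row) :=
  foldl (fun ot i => let! t' := ot in let! r := step3 t' i in
                     Some (fun j => if j == i then r else t' j))
    (Some t) (rev (iota 3 (n - 4))).

(* Returns (sigma_2, w_2, w_1). *)
Definition step4 (t : nat -> row) : option (Kp * Kp * Kp) :=
  let rho2 := (a 2)%:K - sigma (t 4) * (b 2)%:K in
  let psi2 := nonzero_or_p
    ((d 2)%:K - phi (t 4) * (b 2)%:K - sigma (t 3) * rho2) in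
  let! sigma2 := ((c 2)%:K - phi (t 3) * rho2) ./ psi2 in
  let rho1 := (a 1)%:K - sigma (t 3) * (b 1)%:K in
  let psi1 := nonzero_or_p
    ((d 1)%:K - phi (t 3) * (b 1)%:K - sigma2 * rho1) in
  let! w2 := ((y 2)%:K - w (t 4) * (b 2)%:K - w (t 3) * rho2) ./ psi2 in
  let! w1 := ((y 1)%:K - w (t 3) * (b 1)%:K - w2 * rho1) ./ psi1 in
  Some (sigma2, w2, w1).

Fixpoint step5 (t : nat -> row) (sigma2 w2 w1 : Kp) (i : nat) : Kp :=
  match i with
  | 0 => 0
  | 1 => w1
  | 2 => w2 - sigma2 * w1
  | (j.+1 as k).+1 => w (t i) - sigma (t i) * step5 t sigma2 w2 w1 k
                      - phi (t i) * step5 t sigma2 w2 w1 j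
  end.

(* Steps (1)-(5): i |-> x_i (relevant for 1 <= i <= n), or None if some division
   is by zero. The initial table is read only at the indices n and n-1. *)
Definition sptrans2 : option (nat -> Kp) :=
  let! r_n := step1 in
  let! r_n1 := step2 r_n in
  let! t := step3_loop (fun i => if i == n then r_n else r_n1) in
  let! s := step4 t in
  let: (sigma2, w2, w1) := s in
  Some (step5 t sigma2 w2 w1).

End Sptrans2.

(* Main.v *)
(** Replacing a vanishing [psi_i] by [p] amounts to replacing [d_i] by [d_i + p].
    So the algorithm performs, without any zero pivot, the elimination for a
    matrix [M(p)] obtained from [P] by adding [p] to some diagonal entries, and
    the [x_i(p)] solve [M(p) x = Y].  Since [det M(p)] is a polynomial whose value
    at [0] is [det P <> 0], Cramer's rule shows that the [x_i(p)] have no pole at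
    [0], and that their values there solve [P X = Y]. *)
Require Import Defs.
From HB Require Import structures.
From mathcomp Require Import all_boot all_order all_algebra.
From mathcomp Require Import reals.
From mathcomp Require Import complex.
From mathcomp Require Import ring zify.

Set Implicit Arguments.
Unset Strict Implicit.
Unset Printing Implicit Defensive.

Import GRing.Theory.
Local Open Scope ring_scope.

(** * Partial computations and the table-filling loop *)

Lemma obind_Some (A B : Type) (k : A -> option B) (v : A) :
  obind k (Some v) = k v.
Proof. by []. Qed.

Lemma obind_divo (F : fieldType) (A : Type) (x z : F) (k : F -> option A) :
  z != 0 -> obind k (x ./ z) = k (x / z).
Proof. by rewrite /divo => /negPf ->. Qed.

(** Indices are visited downwards, each written once, so the rows [i.+1] and [i.+2] read when row
    [i] is computed are already final; hence [good] survives to the final table. The initial table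
    is universally quantified because the induction changes it. *)
Lemma table_loopP (A : Type) (step : (nat -> A) -> nat -> option A)
    (good : nat -> A -> A -> A -> Prop) :
  (forall t i, exists2 r, step t i = Some r & good i r (t i.+1) (t i.+2)) ->
  forall (t0 : nat -> A) m, exists t : nat -> A,
    [/\ foldl (fun ot i => let! t' := ot in let! r := step t' i in
                     Some (fun j => if j == i then r else t' j))
          (Some t0) (rev (iota 3 m)) = Some t,
        forall i, (3 + m <= i)%N -> t i = t0 i &
        forall i, (3 <= i < 3 + m)%N -> good i (t i) (t i.+1) (t i.+2)].
Proof.
move=> stepP t0 m; elim: m t0 => [|m IHm] t0.
  by exists t0; split=> // i; lia.
(* After reversal the last index [3 + m] comes first: the first iteration is peeled off, and the
   induction hypothesis runs the others on the updated table. *)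
rewrite -[m.+1]addn1 iotaD rev_cat /=.
have [r -> rE] := stepP t0 (3 + m).
have [t [tE t_out t_in]] := IHm (fun j => if j == (3 + m)%N then r else t0 j).
exists t; split=> [//|i im|i im].
  by rewrite t_out ?ifF //; lia.
have [->|i3m] := eqVneq i (3 + m)%N; last by apply: t_in; lia.
by rewrite !t_out ?eqxx ?ifF //; lia.
Qed.

(** * The algebra of one elimination step *)

Lemma sub_mul0 (F : fieldType) (x u : F) : x = x - 0 * u.
Proof. by rewrite mul0r subr0. Qed.

Lemma sub_mul0_mul0 (F : fieldType) (x u v : F) : x = x - 0 * u - 0 * v.
Proof. by rewrite !mul0r !subr0. Qed.

(** Substituting [x2] into the row turns the coefficient of [x1] into [rho]; substituting [x1] then
    turns that of [x] into [psi - q]. The term [q * x] restores the pivot [psi], and what remains is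
    the formula for [x] multiplied by [psi]. *)
Lemma eliminate_identity (F : fieldType) (a b c d e y s1 f1 w1 s2 f2 w2 psi q
    u v x x1 x2 : F) :
  let rho := a - s2 * b in
  psi != 0 -> psi = d - f2 * b - s1 * rho + q ->
  x = (y - w2 * b - w1 * rho) / psi - (c - f1 * rho) / psi * v - e / psi * u ->
  x1 = w1 - s1 * x - f1 * v -> x2 = w2 - s2 * x1 - f2 * x ->
  q * x + (e * u + c * v + d * x + a * x1 + b * x2) = y.
Proof.
move=> rho psi0 psiE xE x1E x2E.
have {}xE : psi * x = y - w2 * b - w1 * rho - (c - f1 * rho) * v - e * u.
  by rewrite xE; field.
have -> : q = psi - (d - f2 * b - s1 * rho) by rewrite psiE addrC addKr.
by rewrite mulrBl xE x2E x1E /rho; ring.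
Qed.

(** * Rows of a pentadiagonal matrix applied to a vector *)

Section PentadiagonalSum.

Variables (K L : fieldType) (f : {rmorphism K -> L}).

Lemma sum_ord_pick (n k : nat) (t : L) (x : nat -> L) :
  \sum_(j < n) (if j == k :> nat then t else 0) * x j.+1 =
  if (k < n)%N then t * x k.+1 else 0.
Proof.
rewrite -(big_mkord xpredT (fun j => (if j == k then t else 0) * x j.+1)).
case: ltnP => kn.
  rewrite (bigD1_seq k) ?mem_index_iota ?iota_uniq //= eqxx big1 ?addr0 //.
  by move=> j /negPf ->; rewrite mul0r.
rewrite big_nat_cond big1 // => j /andP[/andP[_ jn] _].
by rewrite (ltn_eqF (leq_trans jn kn)) mul0r.
Qed.

Lemma penta_mx_sum (n : nat) (a b c d e : nat -> K) (x : nat -> L) (i : 'I_n) :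
  \sum_(j < n) f (penta_mx n a b c d e i j) * x j.+1 =
  (if (1 < i)%N then f (e i.+1) * x i.-1 else 0)
  + (if (0 < i)%N then f (c i.+1) * x i else 0)
  + f (d i.+1) * x i.+1
  + (if (i.+1 < n)%N then f (a i.+1) * x i.+2 else 0)
  + (if (i.+2 < n)%N then f (b i.+1) * x i.+3 else 0).
Proof.
(* Truncated subtraction makes [i.-2] a valid column even in the first two rows, so the boundary
   test is moved into the coefficient; likewise for [c] below. *)
have eE : (if (1 < i)%N then f (e i.+1) * x i.-1 else 0) =
    \sum_(j < n) (if (j == i.-2 :> nat) then
                    if (1 < i)%N then f (e i.+1) else 0 else 0) * x j.+1.
  rewrite sum_ord_pick; have -> : (i.-2 < n)%N by have := ltn_ord i; lia.
  by case: ltnP => i1; rewrite ?mul0r //; congr (_ * x _); lia.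
have cE : (if (0 < i)%N then f (c i.+1) * x i else 0) =
    \sum_(j < n) (if (j == i.-1 :> nat) then
                    if (0 < i)%N then f (c i.+1) else 0 else 0) * x j.+1.
  rewrite sum_ord_pick; have -> : (i.-1 < n)%N by have := ltn_ord i; lia.
  by case: ltnP => i1; rewrite ?mul0r //; congr (_ * x _); lia.
have dE : f (d i.+1) * x i.+1 =
    \sum_(j < n) (if (j == i :> nat) then f (d i.+1) else 0) * x j.+1.
  by rewrite sum_ord_pick ltn_ord.
rewrite eE cE dE -!sum_ord_pick -!big_split /=; apply: eq_bigr => j _.
rewrite -!mulrDl mxE; congr (_ * _).
by do ![case: ifP => ?]; rewrite ?rmorph0 ?(addr0, add0r) //; exfalso; lia.
Qed.

End PentadiagonalSum.

(** * Specialising a perturbed linear system at 0 *)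

Section PerturbedSystem.

Variable K : fieldType.

Local Notation Kp := {fraction {poly K}}.
Local Notation tofrac := (@tofrac {poly K}).
Local Notation "k %:K" := (tofrac (polyC k)) (at level 2, format "k %:K").

Lemma perturbed_solution (n : nat) (P : 'M[K]_n) (y : 'cV[K]_n)
    (q : 'I_n -> {poly K}) (x : 'I_n -> Kp) :
  \det P != 0 -> (forall i, (q i).[0] = 0) ->
  (forall i, tofrac (q i) * x i + \sum_j (P i j)%:K * x j = (y i 0)%:K) ->
  forall i, ~~ has_pole (x i) 0 /\ subst_rat (x i) 0 = (invmx P *m y) i 0.
Proof.
move=> detP q0 sys i.
(* Polynomial entries keep the determinant and the adjugate polynomial, and evaluation at 0 commutes
   with both. *)
pose M : 'M[{poly K}]_n := map_mx polyC P + diag_mx (\row_j q j).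
have M0 : map_mx (horner_eval 0) M = P.
  apply/matrixP => k l; rewrite !mxE /horner_eval hornerD hornerC.
  by rewrite hornerMn q0 mul0rn addr0.
have detM0 : (\det M).[0] = \det P by rewrite -M0 det_map_mx.
have Mx : map_mx tofrac M *m (\col_j x j) = map_mx tofrac (map_mx polyC y).
  apply/matrixP => k l; rewrite ord1 !mxE -sys.
  transitivity (\sum_j ((P k j)%:K * x j + (tofrac (q j) *+ (k == j)) * x j)).
    by apply: eq_bigr => j _; rewrite !mxE tofracD tofracMn mulrDl; case: eqP => // ->.
  rewrite big_split addrC /=; congr (_ + _).
  rewrite (bigD1 k) //= eqxx big1 ?addr0 // => j /negPf jk.
  by rewrite eq_sym jk mul0r.
have detM : tofrac (\det M) != 0 :> Kp.
  by rewrite tofrac_eq0; apply: contraNneq detP => M_0; rewrite -detM0 M_0 horner0.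
(* Cramer's rule, obtained by multiplying the system on the left by the adjugate of [M]. *)
have xE : x i = tofrac ((\adj M *m map_mx polyC y) i 0) / tofrac (\det M).
  apply: (canRL (mulfK detM)).
  have := congr1 (fun A => (map_mx tofrac (\adj M) *m A) i 0) Mx.
  rewrite mulmxA -!map_mxM mul_adj_mx map_scalar_mx mul_scalar_mx !mxE => <-.
  by rewrite mulrC.
have [|npole sE] := @subst_rat_frac K ((\adj M *m map_mx polyC y) i 0) (\det M) 0.
  by rewrite detM0.
rewrite xE; split=> //; rewrite sE detM0.
have -> : ((\adj M *m map_mx polyC y) i 0).[0] = (\adj P *m y) i 0.
  rewrite -M0 -map_mx_adj.
  have -> : y = map_mx (horner_eval 0) (map_mx polyC y).
    by apply/matrixP => k l; rewrite !mxE /horner_eval hornerC.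
  rewrite -map_mxM !mxE /horner_eval; congr (_.[0]).
  apply: eq_bigr => j _; congr (_ * _).
  by rewrite !mxE hornerC.
by rewrite /invmx unitmxE unitfE detP -scalemxAl [in RHS]mxE mulrC.
Qed.

Lemma nonzero_or_pP (psi : Kp) :
  nonzero_or_p psi != 0 /\
  exists2 q : {poly K}, q.[0] = 0 & nonzero_or_p psi = psi + tofrac q.
Proof.
rewrite /nonzero_or_p; case: (eqVneq psi 0) => [->|psi0]; split=> //.
- by rewrite tofrac_eq0 polyX_eq0.
- by exists 'X; rewrite ?hornerX ?add0r.
- by exists 0; rewrite ?horner0 // tofrac0 addr0.
Qed.

Lemma nonzero_or_p_neq0 (psi psi' : Kp) : nonzero_or_p psi = psi' -> psi' != 0.
Proof. by move=> <-; have [] := nonzero_or_pP psi. Qed.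

(** The back-substitution recurrence of step (5), kept as a relation so that rows missing at either
    end can be padded with zeros. *)
Definition row_rel (r : Defs.row K) (u v x : Kp) :=
  x = w r - sigma r * v - phi r * u.

(* [u, v, x, x1, x2] stand for x_(i-2), ..., x_(i+2), the rows [r, r1, r2] for
   those of index i, i+1, i+2, and [q] for the perturbation of d_i. *)
Definition eliminated (a b c d e y : K) (r r1 r2 : Defs.row K) :=
  exists2 q : {poly K}, q.[0] = 0 & forall u v x x1 x2,
    row_rel r u v x -> row_rel r1 v x x1 -> row_rel r2 x x1 x2 ->
    tofrac q * x + (e%:K * u + c%:K * v + d%:K * x + a%:K * x1 + b%:K * x2)
    = y%:K.

(** The intermediate quantities enter through equations, so that one statement covers every step of
    the algorithm, including the boundary rows, where some formulas are shortened. *)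
Lemma elimination_step (a b c d e y : K) (r1 r2 : Defs.row K)
    (rho psi s f v : Kp) :
  a%:K - sigma r2 * b%:K = rho ->
  nonzero_or_p (d%:K - phi r2 * b%:K - sigma r1 * rho) = psi ->
  (c%:K - phi r1 * rho) / psi = s -> e%:K / psi = f ->
  (y%:K - w r2 * b%:K - w r1 * rho) / psi = v ->
  eliminated a b c d e y (Row s f v) r1 r2.
Proof.
move=> <- <- <- <- <-.
set psi0 := _ - sigma r1 * _.
have [psi_neq0 [q q0 psiE]] := nonzero_or_pP psi0.
exists q => // u v0 x x1 x2; rewrite /row_rel /= => xE x1E x2E.
exact: eliminate_identity psi_neq0 psiE xE x1E x2E.
Qed.

End PerturbedSystem.

(** * Each step of the algorithm as an elimination, and their assembly *)

Section Sptrans2Correct.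

Variables (K : fieldType) (n : nat) (a b c d e y : nat -> K).

Local Notation tofrac := (@tofrac {poly K}).
Local Notation zero_row := (Row 0 0 0 : Defs.row K).

(** Row [n] is a general row with [a] and [b] zero, followed by two fictitious zero rows; its [rho]
    is then 0. *)
Lemma step1P : exists2 r, step1 n c d e y = Some r &
  eliminated 0 0 (c n) (d n) (e n) (y n) r zero_row zero_row.
Proof.
rewrite /step1; move psiE: (nonzero_or_p _) => psi.
have psi0 := nonzero_or_p_neq0 psiE.
do 3!rewrite (obind_divo _ _ psi0); eexists; first by [].
apply: (@elimination_step _ _ _ _ _ _ _ _ _ 0 psi);
  by rewrite /= ?tofrac0 ?(mul0r, subr0).
Qed.

Lemma step2P r_n : let i := n.-1 in
  exists2 r, step2 n a c d e y r_n = Some r &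
  eliminated (a i) 0 (c i) (d i) (e i) (y i) r r_n zero_row.
Proof.
move=> i; rewrite /step2 -/i; move rhoE: (tofrac (a i)%:P) => rho.
move psiE: (nonzero_or_p _) => psi.
have psi0 := nonzero_or_p_neq0 psiE.
do 3!rewrite (obind_divo _ _ psi0); eexists; first by [].
apply: (@elimination_step _ _ _ _ _ _ _ _ _ rho psi);
  by rewrite /= ?mul0r ?subr0.
Qed.

Lemma step3P t i : exists2 r, step3 a b c d e y t i = Some r &
  eliminated (a i) (b i) (c i) (d i) (e i) (y i) r (t i.+1) (t i.+2).
Proof.
rewrite /step3; move rhoE: (tofrac (a i)%:P - _) => rho.
move psiE: (nonzero_or_p _) => psi.
have psi0 := nonzero_or_p_neq0 psiE.
do 3!rewrite (obind_divo _ _ psi0); eexists; first by [].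
exact: elimination_step rhoE psiE erefl erefl erefl.
Qed.

Lemma step3_loopP t0 : exists t,
  [/\ step3_loop n a b c d e y t0 = Some t,
      forall i, (n - 2 < i)%N -> (3 <= i)%N -> t i = t0 i &
      forall i, (3 <= i <= n - 2)%N ->
        eliminated (a i) (b i) (c i) (d i) (e i) (y i) (t i) (t i.+1) (t i.+2)].
Proof.
pose good i :=
  @eliminated K (a i) (b i) (c i) (d i) (e i) (y i).
have [t [tE t_out t_in]] := table_loopP (good := good) step3P t0 (n - 4).
(* The loop range [3 <= i < 3 + (n - 4)] is [3 <= i <= n - 2]; both are empty when [n < 5]. *)
by exists t; split=> // i *; [apply: t_out | apply: t_in]; lia.
Qed.

(** The coefficients [e 2], [c 1] and [e 1] lie outside the matrix and are taken to be 0, so the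
    values phi_2, sigma_1 and phi_1 that the algorithm omits are 0 as well. *)
Lemma step4P t : exists sigma2 w2 w1,
  [/\ step4 a b c d y t = Some (sigma2, w2, w1),
      eliminated (a 2) (b 2) (c 2) (d 2) 0 (y 2) (Row sigma2 0 w2) (t 3) (t 4) &
      eliminated (a 1) (b 1) 0 (d 1) 0 (y 1) (Row 0 0 w1)
        (Row sigma2 0 w2) (t 3)].
Proof.
rewrite /step4; move rho2E: (tofrac (a 2)%:P - _) => rho2.
move psi2E: (nonzero_or_p _) => psi2.
have psi20 := nonzero_or_p_neq0 psi2E.
rewrite (obind_divo _ _ psi20); move s2E: ((_ - phi (t 3) * rho2) / psi2) => s2.
move rho1E: (tofrac (a 1)%:P - _) => rho1.
move psi1E: (nonzero_or_p _) => psi1.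
have psi10 := nonzero_or_p_neq0 psi1E.
rewrite (obind_divo _ _ psi20); move v2E: ((_ - w (t 3) * rho2) / psi2) => v2.
rewrite (obind_divo _ _ psi10); move v1E: ((_ - v2 * rho1) / psi1) => v1.
exists s2, v2, v1; split; first reflexivity.
- apply: elimination_step rho2E psi2E s2E _ v2E.
  by rewrite tofrac0 mul0r.
- apply: (elimination_step (r1 := Row s2 0 v2) rho1E psi1E _ _ v1E).
  + by rewrite tofrac0 /= mul0r subrr mul0r.
  + by rewrite tofrac0 mul0r.
Qed.

Lemma sptrans2P : (4 <= n)%N -> exists2 x,
  sptrans2 n a b c d e y = Some x &
  forall i : 'I_n, exists2 q : {poly K}, q.[0] = 0 &
    tofrac q * x i.+1 +
    \sum_j tofrac (penta_mx n a b c d e i j)%:P * x j.+1 = tofrac (y i.+1)%:P.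
Proof.
move=> n4; rewrite /sptrans2.
have [rn -> rnE] := step1P; rewrite obind_Some.
have [rn1 -> rn1E] := step2P rn; rewrite obind_Some.
have [t [-> t_out t_in]] := step3_loopP (fun i => if i == n then rn else rn1).
rewrite obind_Some.
have [sigma2 [w2 [w1 [-> E2 E1]]]] := step4P t; rewrite obind_Some.
exists (step5 t sigma2 w2 w1); [reflexivity | move=> i].
(* The loop stops short of the indices [n.-1] and [n], so the two initial rows are still in
   place. *)
have tn : t n = rn by rewrite t_out ?eqxx //; lia.
have tn1 : t n.-1 = rn1 by rewrite t_out ?ifF //; lia.
set x := step5 t sigma2 w2 w1.
(* The recurrences hold by computation from index 3 on; below it, and beyond [n], the absent
   neighbours are set to 0. Only these relations are used once the body of [x] is cleared. *)
have relx k : row_rel (t k.+3) (x k.+1) (x k.+2) (x k.+3) by [].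
have rel2 : row_rel (Row sigma2 0 w2) 0 (x 1) (x 2) by exact: sub_mul0.
have rel1 : row_rel (Row 0 0 w1) 0 0 (x 1) by exact: sub_mul0_mul0.
have rel0 u v : row_rel zero_row u v 0 by exact: sub_mul0_mul0.
clearbody x.
rewrite (penta_mx_sum (tofrac \o polyC)) /=.
(* Row [i] of the matrix has subscript [i.+1]: subscripts 1 and 2 come from step (4), and [k.+3]
   from the loop, step (2) or step (1). *)
case: i => [[|[|k]] /= kn].
- have [q q0 E] := E1; exists q; first exact: q0.
  rewrite -(E _ _ _ _ _ rel1 rel2 (relx 0%N)) !ifT; try lia.
  by rewrite mulr0 add0r.
- have [q q0 E] := E2; exists q; first exact: q0.
  rewrite -(E _ _ _ _ _ rel2 (relx 0%N) (relx 1%N)) !ifT; try lia.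
  by rewrite mulr0.
have [kin|] := leqP k.+3 (n - 2).
  have [|q q0 E] := t_in k.+3; first by lia.
  exists q; first exact: q0.
  rewrite -(E _ _ _ _ _ (relx k) (relx k.+1) (relx k.+2)) !ifT; try lia.
  by [].
move=> kout; have [kE|kE] : k.+3 = n.-1 \/ k.+3 = n by lia.
- have nE : n = k.+4 by lia.
  rewrite -tn1 -tn -kE nE in rn1E.
  have [q q0 E] := rn1E; exists q; first exact: q0.
  (* The unknown of subscript [n.+1] is set to 0 through the zero row; for the last row both
     following unknowns are. *)
  rewrite -(E _ _ _ _ _ (relx k) (relx k.+1) (rel0 _ _)) nE ltnSn ltnn.
  by rewrite mulr0.
- rewrite -tn -kE in rnE.
  have [q q0 E] := rnE; exists q; first exact: q0.
  rewrite -(E _ _ _ _ _ (relx k) (rel0 _ _) (rel0 _ _)) -kE ltnn ltnNge leqnSn.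
  by rewrite !mulr0.
Qed.

End Sptrans2Correct.

Theorem mainTheorem4 (R : realType) (K : fieldType)
    (hK : K = R :> fieldType \/ K = R[i] :> fieldType)
    (n : nat) (hn : (4 <= n)%N) (a b c d e y : nat -> K) :
  let P := penta_mx n a b c d e in
  let Y : 'cV[K]_n := \col_(i < n) y i.+1 in
  \det P != 0 ->
  exists x : nat -> {fraction {poly K}},
    sptrans2 n a b c d e y = Some x /\
    (forall i : nat, (1 <= i <= n)%N -> ~~ has_pole (x i) 0) /\
    let X : 'cV[K]_n := \col_(i < n) subst_rat (x i.+1) 0 in
    P *m X = Y /\ (forall Z : 'cV[K]_n, P *m Z = Y -> Z = X).
Proof.
move=> P Y detP.
(* The perturbations, found row by row, are gathered into one function [q] on the finite index
   type. *)
have [x xE /fin_all_exists2[q q0 sys]] := sptrans2P a b c d e y hn.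
have sol (i : 'I_n) : ~~ has_pole (x i.+1) 0 /\
    subst_rat (x i.+1) 0 = (invmx P *m Y) i 0.
  apply: (perturbed_solution (q := q) (x := fun j => x j.+1)) => // k.
  by rewrite sys mxE.
have unitP : P \in unitmx by rewrite unitmxE unitfE.
exists x; split=> //; split.
  by case=> // i i_lt; case: (sol (Ordinal i_lt)).
move=> X.
have XE : X = invmx P *m Y.
  by apply/matrixP => i j; rewrite ord1 [LHS]mxE; case: (sol i).
by rewrite XE mulKVmx //; split=> // Z <-; rewrite mulKmx.
Qed.
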